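(* Let $G$ be a finite graph on $n$ vertices with treewidth $tw(G)$, and let $k$ be an integer with $k \geq tw(G)+2$. Then $G$ is $k$-mixing, and the $k$-recoloring diameter of $G$ is at most $2\cdot(n^2+n)$.
   Context: A (proper) $k$-coloring of $G=(V,E)$ is a map $f:V\to\{1,\dots,k\}$ with $f(x)\neq f(y)$ for every edge $xy$. Two $k$-colorings are adjacent if they differ on exactly one vertex. The $k$-recoloring graph $R_k(G)$ has the proper $k$-colorings of $G$ as vertices, with this adjacency. $G$ is $k$-mixing if $R_k(G)$ is connected; the $k$-recoloring diameter of a $k$-mixing graph is the diameter of $R_k(G)$. Treewidth is the usual notion: the minimum over tree decompositions of the largest bag cardinality minus one. *)

(* Defs.v *)
From mathcomp Require Import all_boot all_order all_algebra.
From mathcomp Require Import boolp.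

Set Implicit Arguments.
Unset Strict Implicit.
Unset Printing Implicit Defensive.

Record sgraph := SGraph {
  svertex :> finType;
  sedge : rel svertex;
  sedge_sym : symmetric sedge;
  sedge_irr : irreflexive sedge }.

Definition connected_graph (G : sgraph) : Prop :=
  0 < #|G| /\ forall x y : G, connect (@sedge G) x y.

Definition acyclic_graph (G : sgraph) : Prop :=
  forall c : seq G, 2 < size c -> ~ ucycle (@sedge G) c.

Definition is_tree (G : sgraph) : Prop := connected_graph G /\ acyclic_graph G.

(* The subgraph of G induced by A is connected (possibly empty). *)
Definition connected_in (G : sgraph) (A : {set G}) : Prop :=
  {in A &, forall x y : G,
     connect [rel u v | [&& u \in A, v \in A & sedge u v]] x y}.

Record tree_decomposition (G H : sgraph) (B : H -> {set G}) : Prop :=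
  TreeDecomposition {
    td_tree : is_tree H;
    td_vertex : forall x : G, exists i : H, x \in B i;
    td_edge : forall x y : G, sedge x y ->
      exists i : H, (x \in B i) && (y \in B i);
    td_subtree : forall x : G, connected_in [set i : H | x \in B i] }.

Definition max_bag_card (G H : sgraph) (B : H -> {set G}) : nat :=
  \max_(i : H) #|B i|.

Definition has_tree_decomposition (G : sgraph) (m : nat) : Prop :=
  exists (H : sgraph) (B : H -> {set G}),
    tree_decomposition B /\ max_bag_card B = m.

Lemma has_tree_decomposition_card (G : sgraph) :
  has_tree_decomposition G #|G|.
Proof.
have sym : symmetric (fun _ _ : unit => false) by [].
have irr : irreflexive (fun _ : unit => xpred0 : pred unit) by [].
exists (@SGraph unit (fun _ _ => false) sym irr), (fun _ => [set: G]); split.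
  split.
  - split; first by split=> [|[] []]; rewrite ?card_unit ?connect0.
    by case=> [|a [|b c]] //= _ /andP[].
  - by move=> x; exists tt; rewrite inE.
  - by move=> x y _; exists tt; rewrite !inE.
  - by move=> x [] [] _ _; exact: connect0.
by rewrite /max_bag_card (big_pred1 tt) ?cardsT // => -[].
Qed.

Lemma has_tree_decomposition_ex (G : sgraph) :
  exists m, `[< has_tree_decomposition G m >].
Proof. by exists #|G|; apply/asboolP/has_tree_decomposition_card. Qed.

(* Integer valued, so that the treewidth of the graph without vertices is -1. *)
Definition treewidth (G : sgraph) : int :=
  ((ex_minn (has_tree_decomposition_ex G))%:Z - 1)%R.

Definition walk_of_length (G : sgraph) (x y : G) (m : nat) : bool :=
  [exists p : m.-tuple G, path (@sedge G) x p && (last x p == y)].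

(* Least length of a walk from x to y; the junk value #|G| is returned exactly
   when there is none, since a shortest walk has length less than #|G|. *)
Definition gdist (G : sgraph) (x y : G) : nat :=
  find (walk_of_length x y) (iota 0 #|G|).

Lemma gdistP (G : sgraph) (x y : G) : connect (@sedge G) x y ->
  walk_of_length x y (gdist x y) /\
  forall m, walk_of_length x y m -> gdist x y <= m.
Proof.
case/connectP=> p0 e_p0 ->; case: (shortenP e_p0) => p e_p Up _ {p0 e_p0}.
have walkp : walk_of_length x (last x p) (size p).
  by apply/existsP; exists (in_tuple p); rewrite /= e_p eqxx.
have ltpG : size p < #|G| by have := max_card (mem (x :: p)); rewrite (card_uniqP Up).
have hasw : has (walk_of_length x (last x p)) (iota 0 #|G|).
  by apply/hasP; exists (size p); rewrite // mem_iota.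
have ltdG : gdist x (last x p) < #|G| by rewrite -(size_iota 0 #|G|) -has_find.
split; first by have := nth_find 0 hasw; rewrite nth_iota.
move=> m walkm; rewrite leqNgt; apply/negP => ltmd.
have := before_find 0 ltmd.
by rewrite nth_iota ?(ltn_trans ltmd ltdG) // add0n walkm.
Qed.

Definition diameter (G : sgraph) : nat :=
  \max_(x : G) \max_(y : G) gdist x y.

Definition proper_coloring (G : sgraph) (k : nat) (f : {ffun G -> 'I_k}) : bool :=
  [forall x, forall y, sedge x y ==> (f x != f y)].

Definition coloring (G : sgraph) (k : nat) : finType :=
  {f : {ffun G -> 'I_k} | proper_coloring f}.

Definition recoloring_adj (G : sgraph) (k : nat) : rel (coloring G k) :=
  fun f g => #|[set x | val f x != val g x]| == 1.

Lemma recoloring_adj_sym (G : sgraph) (k : nat) :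
  symmetric (@recoloring_adj G k).
Proof.
by move=> f g; congr (_ == 1); apply: eq_card => x; rewrite !inE eq_sym.
Qed.

Lemma recoloring_adj_irr (G : sgraph) (k : nat) :
  irreflexive (@recoloring_adj G k).
Proof.
move=> f; rewrite /recoloring_adj (_ : [set _ | _] = set0) ?cards0 //.
by apply/setP => x; rewrite !inE eqxx.
Qed.

Definition recoloring_graph (G : sgraph) (k : nat) : sgraph :=
  SGraph (@recoloring_adj_sym G k) (@recoloring_adj_irr G k).

Definition mixing (G : sgraph) (k : nat) : Prop :=
  connected_graph (recoloring_graph G k).

Definition recoloring_diameter (G : sgraph) (k : nat) : nat :=
  diameter (recoloring_graph G k).

(* Main.v *)
Require Import Defs.
From mathcomp Require Import all_boot all_order all_algebra.
From mathcomp Require Import boolp zify.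

(** Give every vertex one of [s.+1] slots, injectively on each bag, and refine the
    tree decomposition so that each node replaces the vertex [w] in one slot of
    the bag by a new vertex [v]; call [v] bad if its colour differs from that of
    [w].  If no vertex is bad, the colouring factors through the slots.

    Suppose that at every node below some bag the colour of [w] still occurs in
    the child bag.  Then the colours of bags only grow downwards, and any colour
    [e] absent from the top bag can be removed from the whole subtree with each
    vertex recoloured at most once: at the topmost nodes introducing [e], remove
    recursively a colour [e'] absent from that bag, then turn [e] into [e'].
    At a lowest node where the colour of [w] does not occur in the child bag,
    removing it from the branch lets [v] take this colour.  If there is no such
    node, some colour can be removed from the graph, and one whole slot takes it.
    Either way bad vertices disappear and none is created.  Each of the at most
    [n - 1] rounds recolours every vertex once, except that each slot is moved
    globally once; so [n ^ 2] steps suffice.  Two colourings that factor through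
    the slots are finally joined by moving each slot at most twice. *)

Set Implicit Arguments.
Unset Strict Implicit.
Unset Printing Implicit Defensive.

(** * Recolouring sequences and walks in the recolouring graph *)

Section Walks.
Variables (G : sgraph) (k : nat).
Implicit Types (f g h : {ffun G -> 'I_k}) (A : {set G}) (c : 'I_k).

Definition recolor f A c : {ffun G -> 'I_k} :=
  [ffun x => if x \in A then c else f x].

(** A step may give its vertex the colour it already has, so the number only bounds the distance
    from above. *)
Inductive reach : nat -> {ffun G -> 'I_k} -> {ffun G -> 'I_k} -> Prop :=
| reach0 f : proper_coloring f -> reach 0 f f
| reachS m f g x c : reach m f g -> proper_coloring (recolor g [set x] c) ->
    reach m.+1 f (recolor g [set x] c).

Lemma proper_coloringP f :
  reflect (forall x y, sedge x y -> f x <> f y) (proper_coloring f).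
Proof.
apply: (iffP forallP) => [pf x y xy|pf x]; last first.
  by apply/forallP => y; apply/implyP => xy; apply/eqP; apply: pf.
by apply/eqP; move: (pf x) => /forallP/(_ y)/implyP; apply.
Qed.

Lemma reach_proper m f g : reach m f g -> proper_coloring f /\ proper_coloring g.
Proof. by elim=> // {}m {}f {}g x c _ [pf pg] ?; split. Qed.

Lemma reach_trans m n f g h : reach m f g -> reach n g h -> reach (m + n) f h.
Proof.
move=> fg gh; elim: gh fg => [{}g _|{}n {}g {}h x c _ IH ph] fg.
  by rewrite addn0.
by rewrite addnS; constructor => //; apply: IH.
Qed.

Lemma reach_sym m f g : reach m f g -> reach m g f.
Proof.
elim=> [{}f pf|{}m {}f {}g x c fg IH pg]; first exact: reach0.
have [pf pg0] := reach_proper fg.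
have E : recolor (recolor g [set x] c) [set x] (g x) = g.
  by apply/ffunP => y; rewrite !ffunE inE; case: eqP => // ->.
rewrite -addn1 addnC; apply: reach_trans IH.
by move: (@reachS 0 _ _ x (g x) (reach0 pg)); rewrite E; apply.
Qed.

(** The vertices of [A] are recoloured one after the other: independence rules out conflicts inside
    [A], and no neighbour of [A] has colour [c] at the start. *)
Lemma reach_recolor f A c : proper_coloring f ->
    (forall x y, x \in A -> y \in A -> ~~ sedge x y) ->
    (forall x y, x \in A -> sedge x y -> f y != c) ->
  reach #|A| f (recolor f A c).
Proof.
move=> /proper_coloringP pf; elim: {A}#|A| {-2}A (erefl #|A|) => [|m IH] A cA indA freeA.
  suff -> : recolor f A c = f by rewrite cA; apply: reach0; apply/proper_coloringP.
  by apply/ffunP => x; rewrite ffunE (cards0_eq cA) inE.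
have /card_gt0P[x xA] : 0 < #|A| by rewrite cA.
have cA' : #|A :\ x| = m by move: cA; rewrite (cardsD1 x) xA => -[].
have E : recolor f A c = recolor (recolor f (A :\ x) c) [set x] c.
  by apply/ffunP => y; rewrite !ffunE !inE; case: eqP => [->|] //=; rewrite xA.
rewrite cA E; apply: reachS.
  rewrite -{1}cA'; apply: IH => // [y z /setD1P[_ yA] /setD1P[_ zA]|y z /setD1P[_ yA]].
    exact: indA.
  exact: freeA.
rewrite -E; apply/proper_coloringP => y z yz; rewrite !ffunE.
case: ifP => yA; case: ifP => zA.
- by have := indA _ _ yA zA; rewrite yz.
- by move/esym; apply/eqP; apply: freeA yz.
- by apply/eqP; apply: (freeA z) => //; rewrite sedge_sym.
- exact: pf.
Qed.

Lemma reach_walk m (f g : recoloring_graph G k) : reach m (val f) (val g) ->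
  exists p, [/\ path (@sedge (recoloring_graph G k)) f p, last f p = g & size p <= m].
Proof.
move: {-1}(val f) {-1}(val g) (erefl (val f)) (erefl (val g)) => vf vg Ef Eg fg.
elim: fg f g Ef Eg => [{}vf _|{}m {}vf {}vg x c fg IH pg] f g Ef Eg.
  by exists [::]; split=> //=; apply: val_inj; rewrite Ef Eg.
have [_ pvg] := reach_proper fg.
have [p [fp lp sp]] := IH f (Sub vg pvg) Ef erefl.
(* An idle step adds nothing to the walk. *)
have [gE|gN] := eqVneq vg (recolor vg [set x] c).
  exists p; split; rewrite // ?lp; last exact: leqW.
  by apply: val_inj; rewrite /= gE Eg.
exists (rcons p g); rewrite rcons_path last_rcons size_rcons; split=> //.
rewrite fp lp /= /recoloring_adj Eg /=.
suff -> : [set y | vg y != recolor vg [set x] c y] = [set x] by rewrite cards1.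
apply/setP => y; rewrite !inE ffunE inE; case: (y =P x) => [->|]; last by rewrite eqxx.
apply: contraNneq gN => gx; apply/eqP/ffunP => z; rewrite ffunE inE.
by case: eqP => // ->.
Qed.

End Walks.

(* Rooted forests, in first-child/next-sibling encoding. *)
Inductive vtree (V : Type) := Leaf | Br of V & vtree V & vtree V.
Arguments Leaf {V}.

(** * Forests of bags and the insertion of vertices into them *)

Section Tree.
Variables (G : sgraph) (s : nat) (slot : G -> 'I_s.+1).

Local Notation ctx := ('I_s.+1 -> option G).
Implicit Types (T : vtree G) (b : ctx) (v x y : G) (W X Y : {set G}).

Fixpoint verts T : seq G :=
  if T is Br v c t then v :: verts c ++ verts t else [::].

(** In [Br v c t] met with bag [b], the vertex [v] replaces the occupant of its slot: the children
    [c] see the bag [upd b v], while the siblings [t] still see [b]. *)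
Definition upd b v : ctx := fun i => if i == slot v then Some v else b i.

Definition ctx_fresh b T := forall i y, b i = Some y -> y \notin verts T.

(* [E]-neighbours of a branch lie in the branch or in the part of its context
   that the root of the branch leaves visible. *)
Fixpoint closed_in (E : G -> G -> Prop) T b : Prop :=
  if T is Br v c t then
    [/\ forall x y, x \in v :: verts c -> E x y ->
          y \in v :: verts c \/ slot y <> slot v /\ b (slot y) = Some y,
        closed_in E c (upd b v) & closed_in E t b]
  else True.

(* Some bag met in [T], started in the bag [b], contains [X]. *)
Fixpoint located (X : {set G}) T b : Prop :=
  {in X, forall x, b (slot x) = Some x} \/
  if T is Br v c t then located X c (upd b v) \/ located X t b else False.

Lemma fresh_child b v c t : uniq (verts (Br v c t)) ->
  ctx_fresh b (Br v c t) -> ctx_fresh (upd b v) c.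
Proof.
move=> /= /andP[vN _] fb i y; rewrite /upd; case: eqP => [_ [<-]|_ /fb].
  by move: vN; rewrite mem_cat negb_or => /andP[].
by rewrite /= inE mem_cat !negb_or => /and3P[].
Qed.

Lemma fresh_sib b v c t : ctx_fresh b (Br v c t) -> ctx_fresh b t.
Proof. by move=> fb i y /fb; rewrite /= inE mem_cat !negb_or => /and3P[]. Qed.

Lemma located_mem X T b x : located X T b -> x \in X ->
  x \in verts T \/ b (slot x) = Some x.
Proof.
elim: T b => [|v c IHc t IHt] b /=; first by case=> // H /H; right.
case=> [H /H|[/IHc Hc /Hc|/IHt Ht /Ht]]; first by right.
- case=> [xc|]; first by left; rewrite inE mem_cat xc orbT.
  rewrite /upd; case: eqP => [_ [->]|_]; last by right.
  by left; rewrite mem_head.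
- by case=> [xt|]; [left; rewrite inE mem_cat xt !orbT | right].
Qed.

Lemma located_sub X Y T b : X \subset Y -> located Y T b -> located X T b.
Proof.
move=> /subsetP XY; elim: T b => [|v c IHc t IHt] b /= [H|H] //.
- by left=> x /XY/H.
- by left=> x /XY/H.
- by right; case: H => [/IHc|/IHt]; [left|right].
Qed.

Lemma closed_in_sub (E E' : G -> G -> Prop) T b : closed_in E T b ->
  (forall x y, x \in verts T -> E' x y -> E x y) -> closed_in E' T b.
Proof.
elim: T b => [|u c IHc t IHt] b //= [cl cc ct] sub; split.
- move=> x y xc xy; apply: (cl x) => //; apply: sub xy.
  by rewrite -cat_cons mem_cat xc.
- by apply: IHc => // x y xc; apply: sub; rewrite inE mem_cat xc orbT.
- by apply: IHt => // x y xt; apply: sub; rewrite inE mem_cat xt !orbT.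
Qed.

(** Hang [v] as a childless node below a bag that contains [X]. The slots of [X] differ from that of
    [v], so [X] survives in the new bag; no old bag changes. *)
Lemma insert_vertex (E E' : G -> G -> Prop) X v T b :
    uniq (verts T) -> ctx_fresh b T -> v \notin verts T ->
    {in X, forall y, slot y != slot v} ->
    (forall x y, E' x y -> [\/ [/\ E x y, x != v & y != v],
       x = v /\ y \in v |: X | y = v /\ x \in v |: X]) ->
    located X T b -> closed_in E T b ->
  exists T', [/\ perm_eq (verts T') (v :: verts T), closed_in E' T' b,
    located (v |: X) T' b & forall Z, located Z T b -> located Z T' b].
Proof.
move=> uT fb vT Xv EE'.
(* A part that avoids [v] and [X] gains no new edge. *)
have nadj T0 b0 : v \notin verts T0 -> (forall x, x \in X -> x \notin verts T0) ->
    closed_in E T0 b0 -> closed_in E' T0 b0.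
  move=> vT0 XT0 /closed_in_sub; apply=> x y xT /EE'[[]//|[xv _]|[_ /setU1P[xv|/XT0]]].
  - by rewrite -xv xT in vT0.
  - by rewrite -xv xT in vT0.
  - by rewrite xT.
have here T0 b0 : ctx_fresh b0 T0 -> v \notin verts T0 ->
    {in X, forall x, b0 (slot x) = Some x} -> closed_in E T0 b0 ->
    exists T', [/\ perm_eq (verts T') (v :: verts T0),
    closed_in E' T' b0, located (v |: X) T' b0 &
    forall Z, located Z T0 b0 -> located Z T' b0].
  move=> fb0 vT0 bX cl; exists (Br v Leaf T0); split=> //.
  + split=> // [x y|]; last by apply: nadj => // x /bX/fb0.
    rewrite inE => /eqP-> /EE'[[_]|[_]|[-> _]]; first by rewrite eqxx.
      case/setU1P=> [->|yX]; first by left; rewrite mem_head.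
      by right; split; [apply/eqP/Xv|exact: bX].
    by left; rewrite mem_head.
  + right; left; left=> x /setU1P[->|xX]; first by rewrite /upd eqxx.
    by rewrite /upd (negPf (Xv _ xX)) bX.
  + by move=> Z H; right; right.
elim: T b uT fb vT => [|u c IHc t IHt] b uT fb vT locX cl.
  by apply: here => //; case: locX.
case: (locX) => [bX|locX']; first exact: here.
move: (uT) => /= /andP[]; rewrite mem_cat cat_uniq => /norP[uc ut] /and3P[Uc /hasPn cNt Ut].
move: (vT); rewrite /= inE mem_cat !negb_or => /and3P[vu vc vt].
case: cl => clu clc clt.
case: locX' => [locc|loct].
- have [c' [pc clc' locc' lc]] := IHc _ Uc (fresh_child uT fb) vc locc clc.
  have mc' : verts c' =i v :: verts c by apply: perm_mem.
  have mu x : (x \in u :: verts c') = (x == v) || (x \in u :: verts c).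
    by rewrite !inE mc' inE orbCA.
  exists (Br u c' t); split.
  + by apply/permP => a; move/permP/(_ a): pc; rewrite /= !count_cat; lia.
  + split=> //.
      move=> x y; rewrite !mu => xS /EE'[[xy xv yv]|[_ /setU1P[->|yX]]|[-> _]].
      * move: xS; rewrite (negPf xv) => /clu/(_ xy)[yc|]; last by right.
        by left; rewrite yc orbT.
      * by left; rewrite eqxx.
      * case: (located_mem locc yX) => [yc|].
          by left; rewrite inE yc !orbT.
        rewrite /upd; case: eqP => [_ [->]|]; last by right.
        by left; rewrite mem_head orbT.
      * by left; rewrite eqxx.
    apply: nadj => // x /(located_mem locc)[xc|].
      by apply: contraTN xc => /cNt.
    rewrite /upd; case: eqP => [_ [<-] //|_ /fb].
    by rewrite /= inE mem_cat !negb_or => /and3P[].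
  + by right; left.
  + by move=> Z /= [|[]] H; [left|right; left; apply: lc|right; right].
- have [t' [pt clt' loct' lt]] := IHt _ Ut (fresh_sib fb) vt loct clt.
  exists (Br u c t'); split.
  + by apply/permP => a; move/permP/(_ a): pt; rewrite /= !count_cat; lia.
  + have XN x : x \in X -> x \notin u :: verts c.
      move=> /(located_mem loct)[xt|/fb].
        rewrite inE negb_or (cNt _ xt) andbT.
        by apply: contraNneq ut => <-.
      by rewrite /= -cat_cons mem_cat negb_or => /andP[].
    split=> //; last by apply: nadj => // x /XN; rewrite inE negb_or => /andP[].
    have vS : v \notin u :: verts c by rewrite inE negb_or vu.
    move=> x y xS /EE'[[xy _ _]|[xv _]|[_ /setU1P[xv|/XN]]].
    * exact: (clu x).
    * by rewrite -xv xS in vS.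
    * by rewrite -xv xS in vS.
    * by rewrite xS.
  + by right; right.
  + by move=> Z /= [|[]] H; [left|right; left|right; right; apply: lt].
Qed.

Definition no_ctx : ctx := fun _ => None.

(** The vertices of [Y :\: X] are hung one by one, each below a bag holding the part of [Y] present
    so far. *)
Lemma insert_set (E : G -> G -> Prop) X Y T : uniq (verts T) ->
    X \subset Y -> (forall y, y \in Y -> y \in verts T -> y \in X) ->
    (forall x y, E x y -> x \in verts T /\ y \in verts T) ->
    {in Y &, injective slot} -> located X T no_ctx ->
    closed_in (fun x y => E x y \/ x \in X /\ y \in X) T no_ctx ->
  exists T', [/\ uniq (verts T'), forall x, (x \in verts T') = (x \in verts T) || (x \in Y),
    closed_in (fun x y => E x y \/ x \in Y /\ y \in Y) T' no_ctx, located Y T' no_ctx &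
    forall Z, located Z T no_ctx -> located Z T' no_ctx].
Proof.
elim: {X}#|Y :\: X| {-2}X (erefl #|Y :\: X|) T => [|m IH] X cYX T uT XY YW EW Yi lT cT.
  have YX : Y = X.
    by apply/eqP; rewrite eqEsubset XY andbT -setD_eq0 (cards0_eq cYX).
  exists T; rewrite YX; split=> // x; apply/esym/orb_idr.
  by move=> /(located_mem lT)[].
have /card_gt0P[v] : 0 < #|Y :\: X| by rewrite cYX.
rewrite inE => /andP[vX vY].
have vT : v \notin verts T by apply: contraNN vX => /YW; apply.
have [|||T1 [pT1 cT1 lT1 T1T]] := @insert_vertex _
    (fun x y => E x y \/ x \in v |: X /\ y \in v |: X) X v T no_ctx uT _ vT _ _ lT cT.
- by [].
- move=> y yX; apply: contraNneq vX => /Yi <- //.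
  exact: (subsetP XY).
- move=> x y [xy|[]].
    have [xT yT] := EW _ _ xy; constructor 1; split; first by left.
      by apply: contraNneq vT => <-.
    by apply: contraNneq vT => <-.
  have [->|xv] := eqVneq x v; first by constructor 2.
  have [->|yv] := eqVneq y v; first by constructor 3.
  rewrite !inE (negPf xv) (negPf yv) /= => xX yX.
  by constructor 1; split=> //; right.
have mT1 x : (x \in verts T1) = (x == v) || (x \in verts T) by rewrite (perm_mem pT1) inE.
have [|||||T2 [uT2 T2W cT2 lT2 T2T]] := IH (v |: X) _ T1 _ _ _ _ Yi lT1 cT1.
- move: cYX; rewrite (cardsD1 v) inE vX vY => -[<-]; apply: eq_card => x.
  by rewrite !inE negb_or andbA.
- by rewrite (perm_uniq pT1) /= uT vT.
- by apply/subsetP => x /setU1P[->//|]; apply: (subsetP XY).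
- by move=> y yY; rewrite mT1 !inE => /orP[->//|/(YW _ yY)->]; rewrite orbT.
- by move=> x y /EW[xT yT]; rewrite !mT1 xT yT !orbT.
exists T2; split=> //; last by move=> Z ZT; apply: T2T; apply: T1T.
by move=> x; rewrite T2W mT1; have [->|] := eqVneq x v; rewrite ?vY ?orbT.
Qed.

End Tree.

(** * Growing a tree decomposition node by node *)

(** Another simple path from [a] to [b] would close up with the edge to a cycle, on at least three
    vertices since the path is neither constant nor the edge itself. *)
Lemma acyclic_bridge (H : sgraph) (a b : H) : acyclic_graph H -> sedge a b ->
  ~~ connect [rel u v | [&& sedge u v, (u, v) != (a, b) & (u, v) != (b, a)]] a b.
Proof.
move=> acH ab; apply/negP => /connectP[p0 /shortenP[p pth up _] lp] {p0}.
apply: (acH (a :: p)).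
  case: p pth up lp => [|x [|y p]] //=.
    by move=> _ _ E; move: ab; rewrite E sedge_irr.
  by move=> /andP[/and3P[_ ne _] _] _ E; rewrite E eqxx in ne.
rewrite /ucycle; apply/andP; split=> //=.
rewrite rcons_path -lp sedge_sym ab andbT.
by apply: sub_path pth => u v /and3P[].
Qed.

Lemma leaving_edge (H : sgraph) (A : {set H}) (x y : H) :
    connect (@sedge H) x y -> x \in A -> y \notin A ->
  exists p j, [/\ p \in A, j \notin A & sedge p j].
Proof.
move=> /connectP[p pth ->]; elim: p x pth => [|z p IH] x /=.
  by move=> _ xA; rewrite xA.
case/andP=> xz pth xA lA; have [zA|zA] := boolP (z \in A); first exact: (IH z).
by exists x, z.
Qed.

(** Nodes are added one at a time to a connected set, each next to an old node [p]. The separation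
    property in the step holds because the edge between [p] and [j] is a bridge. *)
Lemma tree_decomposition_ind (G H : sgraph) (B : H -> {set G})
    (P : {set H} -> Prop) : tree_decomposition B ->
    (forall r, P [set r]) ->
    (forall A p j, P A -> p \in A -> j \notin A ->
      (forall x l, l \in A -> x \in B j -> x \in B l -> x \in B p) ->
      P (j |: A)) ->
  P setT.
Proof.
move=> [[[H0 conH] acH] _ _ subt] P1 PS.
pose relA (A : {set H}) := [rel u v | [&& u \in A, v \in A & sedge u v]].
have symA A : connect_sym (relA A).
  by apply: sym_connect_sym => u v /=; rewrite sedge_sym andbCA.
suff HH n : 0 < n <= #|H| -> exists A, [/\ connected_in A, P A & #|A| = n].
  have [|A [_ PA cA]] := HH #|H|; first by rewrite H0 leqnn.
  suff <- : A = setT by [].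
  by apply/eqP; rewrite eqEcard subsetT cardsT cA leqnn.
elim: n => // -[_ _|n IH /andP[_ nH]].
  have /card_gt0P[r _] := H0; exists [set r]; rewrite cards1; split=> //.
  by move=> x y /set1P-> /set1P->; exact: connect0.
have [|A [conA PA cA]] := IH; first exact: ltnW.
have /card_gt0P[x xA] : 0 < #|A| by rewrite cA.
have /card_gt0P[y] : 0 < #|~: A|.
  by rewrite -(ltn_add2l #|A|) cardsC addn0 cA.
rewrite inE => yA; have [p [j [pA jA pj]]] := leaving_edge (conH x y) xA yA.
exists (j |: A); split.
- have jp : relA (j |: A) j p by rewrite /= !inE eqxx pA orbT sedge_sym.
  have toj z : z \in j |: A -> connect (relA (j |: A)) j z.
    case/setU1P=> [->|zA]; first exact: connect0.
    apply: (@connect_trans _ _ p); first by apply: connect1; exact: jp.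
    apply: connect_sub (conA _ _ pA zA) => u v /and3P[uA vA uv].
    by apply: connect1; rewrite /= !inE uA vA uv !orbT.
  by move=> u v /toj ju /toj; apply: connect_trans; rewrite symA.
(* If [z] were not in [B p], the nodes whose bags contain [z] would join [j] to [l] without [p], and
   [A] joins [l] to [p] without [j]: the bridge would be bypassed. *)
- apply: (PS A p j) => // z l lA zj zl; apply/negPn/negP => zp.
  have := acyclic_bridge acH pj; rewrite sym_connect_sym; last first.
    move=> u v /=; rewrite sedge_sym !xpair_eqE.
    by rewrite [(u == p) && _]andbC [(u == j) && _]andbC; congr (_ && _); rewrite andbC.
  move/negP; apply; apply: (@connect_trans _ _ l).
    have := subt z j l; rewrite !inE => /(_ zj zl).
    apply: connect_sub => u v; rewrite /= !inE => /and3P[zu zv uv].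
    apply: connect1; rewrite /= uv !xpair_eqE /=.
    by apply/andP; split; apply/negP => /andP[/eqP E1 /eqP E2]; move: zp; rewrite -?E1 -?E2 ?zu ?zv.
  apply: connect_sub (conA _ _ lA pA) => u v /and3P[uA vA uv].
  apply: connect1; rewrite /= uv !xpair_eqE /=.
  by apply/andP; split; apply/negP => /andP[/eqP E1 /eqP E2]; move: jA; rewrite -?E1 -?E2 ?uA ?vA.
- by rewrite cardsU1 jA cA.
Qed.

(** * Slots and forest obtained from a tree decomposition *)

Lemma extend_injective (T : finType) (s : nat) (slot : T -> 'I_s.+1)
    (X Y : {set T}) : X \subset Y -> #|Y| <= s.+1 -> {in X &, injective slot} ->
  exists slot', {in Y &, injective slot'} /\
    forall x, x \notin Y :\: X -> slot' x = slot x.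
Proof.
elim: {X}#|Y :\: X| {-2}X (erefl #|Y :\: X|) slot => [|m IH] X cYX slot XY cY sX.
  have -> : Y = X by apply/eqP; rewrite eqEsubset XY andbT -setD_eq0 (cards0_eq cYX).
  by exists slot.
have /card_gt0P[v] : 0 < #|Y :\: X| by rewrite cYX.
rewrite inE => /andP[vX vY].
have /card_gt0P[i] : 0 < #|~: (slot @: X)|.
  rewrite -(ltn_add2l #|slot @: X|) cardsC addn0 card_ord card_in_imset //.
  by apply: leq_trans cY; apply: proper_card; rewrite properE XY; apply/subsetPn; exists v.
rewrite inE => iX; pose slot1 x := if x == v then i else slot x.
have s1X x : x \in X -> slot1 x = slot x.
  by rewrite /slot1; case: eqP => // ->; rewrite (negPf vX).
have s1N x : x \in X -> slot x != i by move=> xX; apply: contraNneq iX => <-; exact: imset_f.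
have [|||slot' [s'Y s'E]] := IH (v |: X) _ slot1 _ cY.
- move: cYX; rewrite (cardsD1 v) inE vX vY => -[<-]; apply: eq_card => x.
  by rewrite !inE negb_or andbA.
- by apply/subsetP => x /setU1P[->//|]; apply: (subsetP XY).
- have s1v : slot1 v = i by rewrite /slot1 eqxx.
  move=> x y /setU1P[->|xX] /setU1P[->|yX] //; rewrite ?s1v ?s1X //.
  + by move=> /esym E; have := s1N _ yX; rewrite E eqxx.
  + by move=> E; have := s1N _ xX; rewrite E eqxx.
  + exact: sX.
exists slot'; split=> // x xN; rewrite s'E.
  by rewrite /slot1; case: eqP xN => // ->; rewrite inE vX vY.
by apply: contraNN xN; rewrite !inE negb_or => /andP[/andP[_ ->] ->].
Qed.

Section Decomposition.
Variables (G H : sgraph) (B : H -> {set G}) (s : nat).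
Hypothesis tdB : tree_decomposition B.
Hypothesis cardB : forall i, #|B i| <= s.+1.

(** When [B j] is added, only [B j :\: B p] needs new slots. By separation no such vertex lies in an
    older bag, so injectivity there survives. *)
Lemma slot_exists : exists slot : G -> 'I_s.+1, forall i, {in B i &, injective slot}.
Proof.
pose P (A : {set H}) := exists slot : G -> 'I_s.+1,
  forall i, i \in A -> {in B i &, injective slot}.
suff [slot Hs] : P setT by exists slot => i; apply: Hs; rewrite inE.
apply: (@tree_decomposition_ind _ _ B P tdB) => [r|A p j [slot Hs] pA jA sep].
  have [||slot [Hs _]] := @extend_injective _ s (fun _ : G => ord0) set0 (B r) _ (cardB r).
  - exact: sub0set.
  - by move=> x y; rewrite inE.
  - by exists slot => i /set1P->.
have [||slot' [s'j s'E]] := @extend_injective _ s slot (B j :&: B p) (B j) _ (cardB j).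
- exact: subsetIl.
- by move=> x y /setIP[_ xp] /setIP[_ yp]; apply: (Hs _ pA).
exists slot' => i /setU1P[->//|iA] x y xi yi.
have E z : z \in B i -> slot' z = slot z.
  move=> zi; apply: s'E; rewrite !inE; apply/negP => /andP[/negP zN zj].
  by apply: zN; rewrite zj (sep z i).
by rewrite !E //; apply: (Hs i).
Qed.

Lemma slot_proper (slot : G -> 'I_s.+1) : (forall i, {in B i &, injective slot}) ->
  forall x y, sedge x y -> slot x != slot y.
Proof.
move=> Hs x y xy; have [i /andP[xi yi]] := td_edge tdB xy.
apply/eqP => /(Hs i _ _ xi yi) E; by rewrite E sedge_irr in xy.
Qed.

(** Each [B j] is inserted starting from [B j :&: B p], which lies in a bag containing [B p]. The
    relation [E A] of sharing a bag replaces adjacency during the induction, since [insert_set]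
    extends a relation by a clique. *)
Lemma vtree_exists (slot : G -> 'I_s.+1) : (forall i, {in B i &, injective slot}) ->
  exists T, [/\ uniq (verts T), forall x, x \in verts T &
    closed_in slot (fun x y => sedge x y) T (@no_ctx G s)].
Proof.
move=> Hs; pose E (A : {set H}) x y := exists2 i, i \in A & x \in B i /\ y \in B i.
pose P (A : {set H}) := exists T, [/\ uniq (verts T),
    forall x, x \in verts T <-> exists2 i, i \in A & x \in B i,
    closed_in slot (E A) T (@no_ctx G s) &
    forall i, i \in A -> located slot (B i) T (@no_ctx G s)].
have [T [uT mT cT _]] : P setT.
  apply: (@tree_decomposition_ind _ _ B P tdB) => [r|A p j [T [uT mT cT lT]] pA jA sep].
    have [|||||||T [uT mT cT lT _]] := @insert_set G s slot (fun _ _ => False) set0 (B r) Leaf.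
    - by [].
    - exact: sub0set.
    - by [].
    - by [].
    - exact: Hs.
    - by left=> x; rewrite inE.
    - by [].
    exists T; split=> // [x||i /set1P->//].
      rewrite mT; split=> [xr|[i /set1P->//]].
      by exists r => //; rewrite inE.
    apply: closed_in_sub cT _ => x y _ [i /set1P-> ?]; by right.
  have [||||||T' [uT' mT' cT' lT' TT']] :=
      @insert_set G s slot (E A) (B j :&: B p) (B j) T uT.
  - exact: subsetIl.
  - by move=> y yj /mT[i iA yi]; rewrite inE yj (sep y i).
  - by move=> x y [i iA [xi yi]]; split; apply/mT; exists i.
  - exact: Hs.
  - by apply: located_sub (lT _ pA); exact: subsetIr.
  - apply: closed_in_sub cT _ => x y _ [//|[/setIP[_ xp] /setIP[_ yp]]].
    by exists p.
  exists T'; split=> // [x||i /setU1P[->//|iA]]; last by apply: TT'; apply: lT.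
    rewrite mT'; split=> [/orP[/mT[i iA xi]|xj]|[i /setU1P[->|iA] xi]].
    + by exists i => //; rewrite inE iA orbT.
    + by exists j => //; rewrite setU11.
    + by rewrite xi orbT.
    + by apply/orP; left; apply/mT; exists i.
  apply: closed_in_sub cT' _ => x y _ [i /setU1P[->|iA] ?]; first by right.
  by left; exists i.
exists T; split=> // [x|].
  by have [i xi] := td_vertex tdB x; apply/mT; exists i; rewrite ?inE.
apply: closed_in_sub cT _ => x y _ /(td_edge tdB)[i /andP[xi yi]].
by exists i; rewrite ?inE.
Qed.

End Decomposition.

(** * Bad vertices and shrinking forests *)

Section Recoloring.
Variables (G : sgraph) (k s : nat) (slot : G -> 'I_s.+1).
Hypothesis slot_proper : forall x y : G, sedge x y -> slot x != slot y.
Hypothesis ltsk : s.+1 < k.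

Local Notation ctx := ('I_s.+1 -> option G).
Local Notation col := {ffun G -> 'I_k}.
Implicit Types (T : vtree G) (b : ctx) (v x y : G) (f g h : col).
Implicit Types (kap : 'I_s.+1 -> 'I_k) (e : 'I_k).

(* [kap] colours the empty slots, which thus behave like isolated vertices. *)
Definition slot_color kap f b i := if b i is Some y then f y else kap i.

Fixpoint bad kap f T b : {set G} :=
  if T is Br v c t then
    (if f v == slot_color kap f b (slot v) then set0 else [set v])
      :|: (bad kap f c (upd slot b v) :|: bad kap f t b)
  else set0.

(** No colour is lost from a bag to its child bag, so the set of absent colours can only shrink on
    the way down. *)
Fixpoint shrinking kap f T b : bool :=
  if T is Br v c t then
    [&& [exists i, slot_color kap f (upd slot b v) i == slot_color kap f b (slot v)],
        shrinking kap f c (upd slot b v) & shrinking kap f t b]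
  else true.

Lemma slot_color_upd kap f b v i :
  slot_color kap f (upd slot b v) i = if i == slot v then f v else slot_color kap f b i.
Proof. by rewrite /slot_color /upd; case: ifP. Qed.

Lemma bad_sub kap f T b : {subset bad kap f T b <= verts T}.
Proof.
elim: T b => [|v c IHc t IHt] b x /=; rewrite ?inE //.
rewrite mem_cat; case/or3P=> [|/IHc->|/IHt->]; rewrite ?orbT //.
by case: ifP; rewrite inE // => _ ->.
Qed.

(** Badness compares two colours in the same slot, so a change that depends only on slot and colour
    preserves every equality. *)
Lemma bad_map kap kap' f f' T b (phi : 'I_s.+1 -> 'I_k -> 'I_k) :
    {in verts T, forall x, f' x = phi (slot x) (f x)} ->
    (forall i, slot_color kap' f' b i = phi i (slot_color kap f b i)) ->
  bad kap' f' T b \subset bad kap f T b.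
Proof.
elim: T b => [|v c IHc t IHt] b //= Hx Hb.
have Hv : f' v = phi (slot v) (f v) by apply: Hx; rewrite mem_head.
apply: setUSS; last apply: setUSS.
- rewrite Hv Hb; case: ifP => [_|ne]; first exact: sub0set.
  by case: ifP => [/eqP fv|_]; [rewrite fv eqxx in ne | exact: subxx].
- apply: IHc => [x xc|i]; first by apply: Hx; rewrite inE mem_cat xc orbT.
  by rewrite !slot_color_upd; case: (i =P slot v) => // ->.
- by apply: IHt => // x xt; apply: Hx; rewrite inE mem_cat xt !orbT.
Qed.

Lemma bad_eq kap f f' T b : {in verts T, f' =1 f} ->
  slot_color kap f' b =1 slot_color kap f b -> bad kap f' T b = bad kap f T b.
Proof.
move=> Hx Hb; apply/eqP; rewrite eqEsubset.
by apply/andP; split; apply: (@bad_map _ _ _ _ _ _ (fun _ => id)) => // x xT; rewrite Hx.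
Qed.

Lemma shrinking_eq kap f f' T b : {in verts T, f' =1 f} ->
  slot_color kap f' b =1 slot_color kap f b ->
  shrinking kap f' T b = shrinking kap f T b.
Proof.
elim: T b => [|v c IHc t IHt] b //= Hx Hb.
have Hu : slot_color kap f' (upd slot b v) =1 slot_color kap f (upd slot b v).
  by move=> i; rewrite !slot_color_upd Hb Hx ?mem_head.
rewrite IHc ?IHt // => [|x xt|x xc].
- by congr (_ && _); apply: eq_existsb => i; rewrite Hu Hb.
- by apply: Hx; rewrite inE mem_cat xt !orbT.
- by apply: Hx; rewrite inE mem_cat xc orbT.
Qed.

Lemma slot_color_eq kap f f' b : (forall i y, b i = Some y -> f' y = f y) ->
  slot_color kap f' b =1 slot_color kap f b.
Proof. by move=> H i; rewrite /slot_color; case Eb: (b i) => [y|//]; apply: H Eb. Qed.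

Lemma avoid_slot_colors kap f b : exists e, forall i, slot_color kap f b i != e.
Proof.
have /card_gt0P[e] : 0 < #|~: [set slot_color kap f b i | i : 'I_s.+1]|.
  rewrite -(ltn_add2l #|[set slot_color kap f b i | i : 'I_s.+1]|) cardsC addn0 card_ord.
  by apply: leq_ltn_trans (leq_imset_card _ _) _; rewrite card_ord.
rewrite inE => eN; exists e => i; apply: contraNneq eN => <-.
exact: imset_f.
Qed.

(** * Removing a colour from a branch and repairing a bad vertex *)

Definition tree_ok T b :=
  [/\ uniq (verts T), ctx_fresh b T & closed_in slot (fun x y => sedge x y) T b].

Lemma tree_ok_child v c t b : tree_ok (Br v c t) b -> tree_ok c (upd slot b v).
Proof.
move=> [uT fb [_ cc _]]; split=> //; last exact: fresh_child uT fb.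
by move: uT; rewrite /= cat_uniq => /and4P[].
Qed.

Lemma tree_ok_sib v c t b : tree_ok (Br v c t) b -> tree_ok t b.
Proof.
move=> [uT fb [_ _ ct]]; split=> //; last exact: fresh_sib fb.
by move: uT; rewrite /= cat_uniq => /and4P[].
Qed.

Lemma tree_ok_branch v c t b : tree_ok (Br v c t) b ->
  [/\ v \notin verts c, {in v :: verts c, forall x, x \notin verts t} &
      forall i y, b i = Some y -> y \notin v :: verts c].
Proof.
move=> [uT fb _]; move: uT; rewrite /= mem_cat cat_uniq => /and3P[/norP[vc vt] _].
case/andP=> /hasPn cNt _; split=> // [x|i y /fb].
  by rewrite inE => /orP[/eqP->//|xc]; apply: contraTN xc => /cNt.
by rewrite /= -cat_cons mem_cat negb_or => /andP[].
Qed.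

(* The vertices of [A], all in [S], have been recoloured once each, so that
   [e] is unused on [S], and only with colours that do not occur in [b]. *)
Definition freed kap b (S : seq G) e f g (A : {set G}) :=
  [/\ reach #|A| f g,
      forall x, x \in A -> x \in S /\ forall i, slot_color kap f b i != g x,
      forall x, x \notin A -> g x = f x &
      {in S, forall x, g x != e}].

Lemma reach_disjoint f g h (A B : {set G}) : reach #|A| f g -> reach #|B| g h ->
  (forall x, x \in A -> x \notin B) -> reach #|A :|: B| f h.
Proof.
move=> fg gh AB; have /setP AB0 : forall x, (x \in A :&: B) = (x \in set0).
  by move=> x; rewrite !inE; case: (boolP (x \in A)) => //= /AB/negPf.
by rewrite cardsU AB0 cards0 subn0; apply: reach_trans gh.
Qed.

(** Induction step of [free_color] for one branch. If [v] has colour [e], a colour [e'] absent from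
    the child bag is first removed below; then [e] turns into [e'] throughout the branch. *)
Lemma free_branch kap f v c t b e : tree_ok (Br v c t) b -> proper_coloring f ->
    (exists i, slot_color kap f (upd slot b v) i = slot_color kap f b (slot v)) ->
    (forall i, slot_color kap f b i != e) ->
    (forall e', (forall i, slot_color kap f (upd slot b v) i != e') ->
       exists g A, freed kap (upd slot b v) (verts c) e' f g A /\
         bad kap g c (upd slot b v) \subset bad kap f c (upd slot b v)) ->
  exists g A, [/\ freed kap b (v :: verts c) e f g A,
    bad kap g c (upd slot b v) \subset bad kap f c (upd slot b v) &
    g v = f v \/ f v = e].
Proof.
move=> ok pf [i0 Ei0] be IH; have [vc ct bN] := tree_ok_branch ok.
(* Only the slot of [v] changes, and its old colour survives in the child bag. *)
have Nub e' : (forall i, slot_color kap f (upd slot b v) i != e') ->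
    forall i, slot_color kap f b i != e'.
  move=> H i; have := H i; rewrite slot_color_upd; case: (i =P slot v) => // -> _.
  by rewrite -Ei0.
have [fve|fve] := eqVneq (f v) e; last first.
  have [|g [A [[r cA oA gS] sb]]] := IH e.
    by move=> i; rewrite slot_color_upd; case: ifP.
  have gv : g v = f v by apply: oA; apply: contraNN vc => /cA[].
  exists g, A; split=> //; last by left.
  split=> // [x /cA[xc /Nub xN]|x]; first by rewrite inE xc orbT.
  by rewrite inE => /orP[/eqP->|/gS//]; rewrite gv.
have [e' e'N] := avoid_slot_colors kap f (upd slot b v).
have [g [A [[r cA oA gS] sb]]] := IH e' e'N.
have gv : g v = e by rewrite -fve; apply: oA; apply: contraNN vc => /cA[].
have e'e : e != e' by have := e'N (slot v); rewrite slot_color_upd eqxx fve.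
have gb i y : b i = Some y -> g y = f y.
  move=> /bN yS; apply: oA; apply: contraNN yS => /cA[yc _].
  by rewrite inE yc orbT.
pose D := [set x in v :: verts c | g x == e].
have [_ pg] := reach_proper r; have /proper_coloringP pg' := pg.
have rD : reach #|D| g (recolor g D e').
  apply: reach_recolor => // [x y|x y].
    rewrite !inE => /andP[_ /eqP gx] /andP[_ /eqP gy].
    by apply/negP => /pg'; rewrite gx gy.
  rewrite inE => /andP[xS _] xy.
  case: ok => _ _ [cl _ _]; case: (cl x y xS xy) => [|[sy by_]].
    by rewrite inE => /orP[/eqP->|/gS//]; rewrite gv.
  have := e'N (slot y); rewrite slot_color_upd (introF eqP sy).
  by rewrite /slot_color by_ (gb _ _ by_).
(* Vertices of [A] received colours absent from the child bag, where [e] occurs as the colour of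
   [v]; so nothing is recoloured twice. *)
have AD x : x \in A -> x \notin D.
  move=> /cA[_ /(_ (slot v))]; rewrite slot_color_upd eqxx fve inE negb_and => gx.
  by rewrite eq_sym gx orbT.
exists (recolor g D e'), (A :|: D); split.
- split=> [|x|x|x xS].
  + exact: reach_disjoint r rD AD.
  + rewrite ffunE; case: ifP => [|xD].
      by rewrite inE => /andP[xS _] _; split=> //; apply: Nub.
    by rewrite inE xD orbF => /cA[xc /Nub xN]; rewrite inE xc orbT.
  + by rewrite inE negb_or ffunE => /andP[xA /negPf->]; apply: oA.
  + by rewrite ffunE inE xS /=; case: (g x =P e) => [_|/eqP//]; rewrite eq_sym.
- apply: subset_trans sb.
  apply: (@bad_map _ _ _ _ _ _ (fun _ a => if a == e then e' else a)) => [x xc|i].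
    by rewrite ffunE inE [x \in _ :: _]inE xc orbT.
  rewrite !slot_color_upd; case: (i =P slot v) => _.
    by rewrite ffunE inE mem_head gv eqxx.
  have := be i; rewrite /slot_color; case Eb: (b i) => [y|] /negPf.
    by rewrite -(gb _ _ Eb) ffunE inE (negPf (bN _ _ Eb)) /= => ->.
  by move=> ->.
- by right.
Qed.

(** The siblings are treated first, then the branch of [v]. Neither recolouring touches the other
    part or the bag [b], so the recoloured sets are disjoint. *)
Lemma free_color kap f T b e : tree_ok T b -> proper_coloring f ->
    shrinking kap f T b -> (forall i, slot_color kap f b i != e) ->
  exists g A, freed kap b (verts T) e f g A /\ bad kap g T b \subset bad kap f T b.
Proof.
elim: T b f e => [|v c IHc t IHt] b f e ok pf.
  move=> _ _; exists f, set0; split=> //; split=> // [|x]; last by rewrite inE.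
  by rewrite cards0; apply: reach0.
move=> /and3P[shv shc sht] be.
have [vc ct bN] := tree_ok_branch ok; have fbt := fresh_sib (let: And3 _ fb _ := ok in fb).
have [g1 [A1 [[r1 cA1 oA1 g1t] sb1]]] := IHt b f e (tree_ok_sib ok) pf sht be.
have [_ pg1] := reach_proper r1.
have g1S : {in v :: verts c, g1 =1 f}.
  by move=> x /ct xt; apply: oA1; apply: contraNN xt => /cA1[].
have g1b : slot_color kap g1 b =1 slot_color kap f b.
  apply: slot_color_eq => i y /fbt yt; apply: oA1.
  by apply: contraNN yt => /cA1[].
have g1c : {in verts c, g1 =1 f} by move=> x xc; apply: g1S; rewrite inE xc orbT.
have g1u : slot_color kap g1 (upd slot b v) =1 slot_color kap f (upd slot b v).
  by move=> i; rewrite !slot_color_upd g1b g1S ?mem_head.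
have [|||g2 [A2 [[r2 cA2 oA2 g2S] sb2 g2v]]] := @free_branch kap g1 v c t b e ok pg1.
- by have /existsP[i /eqP Ei] := shv; exists i; rewrite g1u g1b.
- by move=> i; rewrite g1b.
- move=> e' e'N; apply: IHc => //; first exact: tree_ok_child ok.
  by rewrite (shrinking_eq g1c g1u).
have A12 x : x \in A1 -> x \notin A2.
  by move=> /cA1[xt _]; apply: contraTN xt => /cA2[/ct].
have g2t : {in verts t, g2 =1 g1}.
  by move=> x xt; apply: oA2; apply: contraTN xt => /cA2[/ct].
have g2b : slot_color kap g2 b =1 slot_color kap g1 b.
  apply: slot_color_eq => i y /bN yS; apply: oA2.
  by apply: contraNN yS => /cA2[].
exists g2, (A1 :|: A2); split.
  split.
  - exact: reach_disjoint r1 r2 A12.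
  - move=> x /setUP[/cA1|/cA2] [xS xN]; rewrite /= -cat_cons mem_cat xS ?orbT.
      by rewrite g2t.
    by split=> // i; rewrite -g1b.
  - by move=> x; rewrite inE negb_or => /andP[x1 x2]; rewrite oA2 // oA1.
  - move=> x; rewrite /= -cat_cons mem_cat => /orP[/g2S//|xt].
    by rewrite g2t // g1t.
rewrite /= (bad_eq g2t g2b); apply: setUSS; last apply: setUSS => //.
  (* Either [v] kept its colour, or it had colour [e], which is absent from [b], and was bad
     already. *)
  rewrite g2b g1b; case: g2v => [->|].
    by rewrite g1S ?mem_head.
  rewrite g1S ?mem_head // => fve.
  have /negPf : f v != slot_color kap f b (slot v) by rewrite fve eq_sym be.
  by move=> ->; case: ifP; rewrite ?sub0set.
by rewrite -(bad_eq g1c g1u).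
Qed.

(** At a lowest node where shrinking fails, the colour [a] of the replaced slot is absent from the
    child bag. It can be removed from the forest below, and then [v] takes it and is no longer
    bad. *)
Lemma unify_branch kap f T b : tree_ok T b -> proper_coloring f ->
    ~~ shrinking kap f T b ->
  exists g (A : {set G}), [/\ reach #|A| f g, {subset A <= verts T},
    forall x, x \notin A -> g x = f x, bad kap g T b \subset bad kap f T b &
    exists2 x, x \in bad kap f T b & x \notin bad kap g T b].
Proof.
elim: T b => [|v c IHc t IHt] b // ok pf.
have [vc ct bN] := tree_ok_branch ok; have fbt := fresh_sib (let: And3 _ fb _ := ok in fb).
have okc := tree_ok_child ok; have okt := tree_ok_sib ok.
have badtN h x : x \in v :: verts c -> x \notin bad kap h t b.
  by move=> /ct; apply: contraNN => /bad_sub.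
have subc x : x \in verts c -> x \in v :: verts c by rewrite inE => ->; rewrite orbT.
have outside g (A : {set G}) : {subset A <= v :: verts c} ->
    (forall x, x \notin A -> g x = f x) ->
    slot_color kap g b =1 slot_color kap f b /\ bad kap g t b = bad kap f t b.
  move=> cA oA.
  have gb : slot_color kap g b =1 slot_color kap f b.
    apply: slot_color_eq => i y /bN yS; apply: oA.
    by apply: contraNN yS => /cA.
  split=> //; apply: bad_eq => // x xt; apply: oA.
  by apply: contraTN xt => /cA/ct.
rewrite /= !negb_and => sh.
(* Children and siblings are searched first, so in the last case both are shrinking and the failure
   is at [v]. *)
have [shc|/negPn shc] := boolP (~~ shrinking kap f c (upd slot b v)).
  have [g [A [r cA oA sb [x xf xg]]]] := IHc _ okc pf shc.
  have gv : g v = f v by apply: oA; apply: contraNN vc => /cA.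
  have [gb gt] := outside g A (fun x xA => subc x (cA x xA)) oA.
  have xc := bad_sub xf; have xv : x != v by apply: contraNneq vc => <-.
  exists g, A; rewrite gv gb gt; split=> //.
  - by move=> y /cA yc; rewrite inE mem_cat yc orbT.
  - by apply: setUS; apply: setSU.
  - exists x; first by rewrite !inE xf orbT.
    rewrite !inE (negPf xg) (negPf (badtN _ _ (subc _ xc))) !orbF.
    by case: ifP; rewrite !inE.
have [sht|/negPn sht] := boolP (~~ shrinking kap f t b).
  have [g [A [r cA oA sb [x xf xg]]]] := IHt _ okt pf sht.
  have gS y : y \in v :: verts c -> g y = f y.
    by move=> /ct yt; apply: oA; apply: contraNN yt => /cA.
  have gb : slot_color kap g b =1 slot_color kap f b.
    by apply: slot_color_eq => i y /fbt yt; apply: oA; apply: contraNN yt => /cA.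
  have gc : bad kap g c (upd slot b v) = bad kap f c (upd slot b v).
    apply: bad_eq => [y /subc/gS//|i].
    by rewrite !slot_color_upd gb gS ?mem_head.
  have xt := bad_sub xf.
  have xS : x \notin v :: verts c by apply: contraTN xt => /ct.
  exists g, A; rewrite gS ?mem_head // gb gc; split=> //.
  - by move=> y /cA yt; rewrite inE mem_cat yt !orbT.
  - by apply: setUS; apply: setUS.
  - exists x; first by rewrite !inE xf !orbT.
    move: xS; rewrite !inE (negPf xg) orbF !negb_or => /andP[xv xc].
    apply/andP; split; first by case: ifP; rewrite !inE.
    by apply: contraNN xc => /bad_sub.
move: sh; rewrite shc sht !orbF negb_exists => /forallP shv {IHc IHt}.
pose a := slot_color kap f b (slot v).
have [g1 [A1 [[r1 cA1 oA1 g1a] sb1]]] := @free_color kap f c (upd slot b v) a okc pf shc shv.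
have fva : f v != a by have := shv (slot v); rewrite slot_color_upd eqxx.
have g1v : g1 v = f v by apply: oA1; apply: contraNN vc => /cA1[].
have g1b i y : b i = Some y -> g1 y = f y.
  by move=> /bN yS; apply: oA1; apply: contraNN yS => /cA1[/subc].
(* All vertices of this slot with the colour of [v] follow it; recolouring [v] alone could make
   vertices below it bad. *)
pose D := [set x in v :: verts c | (slot x == slot v) && (g1 x == f v)].
have [_ pg] := reach_proper r1; have /proper_coloringP pg' := pg.
have rD : reach #|D| g1 (recolor g1 D a).
  apply: reach_recolor => // [x y|x y].
    rewrite !inE => /and3P[_ _ /eqP gx] /and3P[_ _ /eqP gy].
    by apply/negP => /pg'; rewrite gx gy.
  rewrite inE => /andP[xS _] xy.
  case: ok => _ _ [cl _ _]; case: (cl x y xS xy) => [|[sy by_]].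
    by rewrite inE => /orP[/eqP->|/g1a//]; rewrite g1v.
  have := shv (slot y); rewrite slot_color_upd (introF eqP sy).
  by rewrite /slot_color by_ (g1b _ _ by_).
have AD x : x \in A1 -> x \notin D.
  move=> /cA1[_ /(_ (slot v))]; rewrite slot_color_upd eqxx inE !negb_and => gx.
  by rewrite [g1 x == _]eq_sym gx !orbT.
have cAD : {subset A1 :|: D <= v :: verts c}.
  by move=> x /setUP[/cA1[/subc]//|]; rewrite inE => /andP[].
have oAD x : x \notin A1 :|: D -> recolor g1 D a x = f x.
  by rewrite inE negb_or ffunE => /andP[xA /negPf->]; apply: oA1.
have [gb gt] := outside _ _ cAD oAD.
have vD : v \in D by rewrite inE mem_head g1v !eqxx.
exists (recolor g1 D a), (A1 :|: D); split=> //.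
- exact: reach_disjoint r1 rD AD.
- by move=> x /cAD xS; rewrite -cat_cons mem_cat xS.
- rewrite gb gt ffunE vD -/a eqxx set0U; apply: subset_trans (subsetUr _ _).
  apply: setSU; apply: subset_trans sb1.
  apply: (@bad_map _ _ _ _ _ _
    (fun i o => if (i == slot v) && (o == f v) then a else o)) => [x xc|i].
    by rewrite ffunE inE subc.
  rewrite !slot_color_upd; case: (i =P slot v) => _ /=.
    by rewrite ffunE vD g1v eqxx.
  rewrite /slot_color; case Eb: (b i) => [y|//].
  by rewrite ffunE inE (negPf (bN _ _ Eb)).
- exists v; first by rewrite -/a (negPf fva) !inE eqxx.
  rewrite gb ffunE vD -/a eqxx !inE (negPf (badtN _ _ (mem_head _ _))) orbF.
  by apply: contraNN vc => /bad_sub.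
Qed.

(** * Reaching a colouring that factors through the slots *)

Lemma bad_slot kap f T b i e : (forall x, slot x = i -> f x = e) ->
  slot_color kap f b i = e -> {in bad kap f T b, forall x, slot x != i}.
Proof.
move=> fi; elim: T b => [|v c IHc t IHt] b bi x /=; rewrite ?inE //.
case/or3P; last exact: IHt.
  case: ifP; rewrite inE // => ne /eqP->.
  by apply: contraFneq ne => vi; rewrite vi bi fi.
by apply: IHc; rewrite slot_color_upd; case: (i =P slot v) => // E; apply: fi.
Qed.

Lemma bad0_color kap f T b : bad kap f T b = set0 -> slot_color kap f b =1 kap ->
  {in verts T, forall x, f x = kap (slot x)}.
Proof.
elim: T b => [|v c IHc t IHt] b //= /eqP; rewrite !setU_eq0.
move=> /and3P[gv /eqP bc /eqP bt] fb.
have fv : f v = kap (slot v).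
  rewrite -fb; apply/eqP; apply: contraTT gv => /negPf->.
  by apply/set0Pn; exists v; rewrite set11.
move=> x; rewrite inE mem_cat => /or3P[/eqP->//| |]; last exact: IHt bt fb x.
by apply: (IHc _ bc) => i; rewrite slot_color_upd; case: (i =P slot v) => // ->.
Qed.

Definition slot_coloring kap : col := [ffun x => kap (slot x)].

Section Normalize.
Variable T : vtree G.
Hypotheses (okT : tree_ok T (@no_ctx G s)) (allT : forall x, x \in verts T).

Local Notation badT kap f := (bad kap f T (@no_ctx G s)).

(** Each round charges [#|G|] to a bad vertex that disappears. The second term pays for the global
    move of a slot, which then contains no bad vertex. *)
Definition potential kap f :=
  #|G| * #|badT kap f| + #|[set x | slot x \in slot @: badT kap f]|.

(** If shrinking fails, one bad vertex is repaired; otherwise a colour is freed in the whole graph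
    and the entire slot of a bad vertex takes it. *)
Lemma normalize_step kap f : proper_coloring f -> badT kap f != set0 ->
  exists kap' g m, [/\ reach m f g, m + potential kap' g <= potential kap f &
    #|badT kap' g| < #|badT kap f|].
Proof.
move=> pf /set0Pn[x0 x0f].
(* Accounting for both cases: [D] is the slot class moved globally, or empty. *)
have potS kp g (D : {set G}) x1 : x1 \in badT kap f ->
    badT kp g \subset badT kap f :\ x1 ->
    (forall x, x \in D -> slot x = slot x1) ->
    {in badT kp g, forall x y, y \in D -> slot x != slot y} ->
    #|G| + #|D| + potential kp g <= potential kap f.
  move=> x1f sb Dx Dg; have := subset_leq_card sb.
  rewrite /potential (cardsD1 x1 (badT kap f)) x1f => cb.
  have : #|D :|: [set x | slot x \in slot @: badT kp g]| <=
         #|[set x | slot x \in slot @: badT kap f]|.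
    apply/subset_leq_card/subsetP => x; rewrite !inE => /orP[/Dx->|].
      exact: imset_f.
    case/imsetP=> y /(subsetP sb)/setD1P[_ yf] ->; exact: imset_f.
  rewrite cardsU (_ : D :&: _ = set0) ?cards0 => [cD|]; first nia.
  apply/setP => y; rewrite !inE; apply/negP => /andP[yD /imsetP[x xg E]].
  by have := Dg x xg y yD; rewrite E eqxx.
have [sh|nsh] := boolP (shrinking kap f T (@no_ctx G s)); last first.
  have [g [A [r _ _ sb [x xf xg]]]] := unify_branch okT pf nsh.
  have sbx : badT kap g \subset badT kap f :\ x.
    by rewrite subsetD1 sb.
  exists kap, g, #|A|; split=> //.
    apply: leq_trans (potS kap g set0 x xf sbx _ _).
    - by rewrite cards0 addn0 leq_add2r max_card.
    - by move=> y; rewrite inE.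
    - by move=> y _ z; rewrite inE.
  by apply: leq_ltn_trans (subset_leq_card sbx) _; rewrite [ltnRHS](cardsD1 x) xf.
have [e eN] := avoid_slot_colors kap f (@no_ctx G s).
have [g [A [[r cA oA gN] sb]]] := free_color okT pf sh eN.
pose D := [set x | slot x == slot x0].
(* The empty top bag must follow the slot for [bad_map] to apply. *)
pose kap' i := if i == slot x0 then e else kap i.
have [_ pg] := reach_proper r.
have rD : reach #|D| g (recolor g D e).
  apply: reach_recolor => // x y; rewrite !inE => /eqP sx.
    by move=> /eqP sy; apply: contraT => /negPn/slot_proper; rewrite sx sy eqxx.
  by move=> _; apply: gN.
have bD : {in badT kap' (recolor g D e), forall x, slot x != slot x0}.
  apply: (@bad_slot _ _ _ _ _ e) => [x /eqP sx|].
    by rewrite ffunE inE sx.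
  by rewrite /slot_color /= /kap' eqxx.
have sb' : badT kap' (recolor g D e) \subset badT kap f :\ x0.
  apply/subsetP => x xb; rewrite in_setD1; apply/andP; split.
    by apply: contraTneq (bD _ xb) => ->; rewrite eqxx.
  apply: (subsetP sb); apply: subsetP xb.
  apply: (@bad_map _ _ _ _ _ _ (fun i o => if i == slot x0 then e else o)) => [y _|i //].
  by rewrite ffunE inE.
exists kap', (recolor g D e), (#|A| + #|D|); split.
- exact: reach_trans rD.
- apply: leq_trans (potS kap' (recolor g D e) D x0 x0f sb' _ _).
  + by rewrite leq_add2r leq_add2r max_card.
  + by move=> x; rewrite inE => /eqP.
  + by move=> x /bD xx0 y; rewrite inE => /eqP->.
- by apply: leq_ltn_trans (subset_leq_card sb') _; rewrite [ltnRHS](cardsD1 x0) x0f.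
Qed.

Lemma normalize kap f : proper_coloring f -> exists kap' m,
  reach m f (slot_coloring kap') /\ m <= potential kap f.
Proof.
have [n cb] := ubnP #|badT kap f|; elim: n kap f cb => // n IH kap f cb pf.
have [b0|bN] := eqVneq (badT kap f) set0.
  exists kap, 0; split=> //.
  suff <- : f = slot_coloring kap by exact: reach0.
  by apply/ffunP => x; rewrite ffunE (bad0_color b0).
have [kap1 [g [m [r le lt]]]] := normalize_step pf bN.
have [_ pg] := reach_proper r.
have [kap' [m' [r' le']]] := IH kap1 g (leq_trans lt cb) pg.
exists kap', (m + m'); split; first exact: reach_trans r'.
by apply: leq_trans le; rewrite leq_add2l.
Qed.

(** Colouring all empty slots like the first vertex of the forest makes that vertex good. At most
    [n - 1] bad vertices then give the potential [n * (n - 1) + n]. *)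
Lemma normalize_sqr f : proper_coloring f -> exists kap m,
  reach m f (slot_coloring kap) /\ m <= #|G| ^ 2.
Proof.
move=> pf; case ET: T => [|v c t].
  have noG x : False by have := allT x; rewrite ET.
  exists (fun i => Ordinal (ltnW ltsk)), 0; split=> //.
  suff <- : f = slot_coloring (fun i => Ordinal (ltnW ltsk)) by exact: reach0.
  by apply/ffunP => x; case: (noG x).
have [kap [m [r le]]] := normalize (fun=> f v) pf.
exists kap, m; split=> //; apply: leq_trans le _.
have vb : v \notin badT (fun=> f v) f.
  have := okT; rewrite ET => ok; have [vc ct _] := tree_ok_branch ok.
  rewrite /= {1}/slot_color /= eqxx !inE /= negb_or; apply/andP; split.
    by apply: contraNN vc => /bad_sub.
  by apply: contraNN (ct _ (mem_head _ _)) => /bad_sub.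
have : #|badT (fun=> f v) f| < #|G|.
  rewrite -cardsT; apply: proper_card; rewrite properT.
  by apply: contraNneq vb => ->.
have : #|[set x | slot x \in slot @: badT (fun=> f v) f]| <= #|G| by exact: max_card.
by rewrite /potential; nia.
Qed.

End Normalize.

(** * Moving between two colourings of the slots *)

Definition slot_class i : {set G} := [set x | slot x == i].

Lemma recolor_slot kap i e : proper_coloring (slot_coloring kap) ->
    (forall x y, slot x = i -> sedge x y -> kap (slot y) != e) ->
  reach #|slot_class i| (slot_coloring kap)
    (slot_coloring (fun j => if j == i then e else kap j)).
Proof.
move=> pk free.
suff -> : slot_coloring (fun j => if j == i then e else kap j) =
    recolor (slot_coloring kap) (slot_class i) e.
  apply: reach_recolor => // x y; rewrite !inE => /eqP sx.
    by move=> /eqP sy; apply: contraT => /negPn/slot_proper; rewrite sx sy eqxx.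
  by move=> xy; rewrite ffunE; apply: free xy.
by apply/ffunP => x; rewrite !ffunE inE.
Qed.

Definition weight (U : {set 'I_s.+1}) := #|[set x | slot x \in U]|.

Lemma weightD1 (U : {set 'I_s.+1}) i : i \in U ->
  weight U = #|slot_class i| + weight (U :\ i).
Proof.
move=> iU; rewrite /weight -(cardsID (slot_class i)); congr (_ + _).
  by apply: eq_card => x; rewrite !inE; case: eqP => [->|]; rewrite ?iU ?andbF.
by apply: eq_card => x; rewrite !inE andbC.
Qed.

(* [U] holds the slots not yet in place and [U :\: V] those that were moved out
   of the way to a colour that no slot of [U] aims at; each slot is moved at most
   twice. *)
Lemma permute_slots kap kap' (U V : {set 'I_s.+1}) :
    proper_coloring (slot_coloring kap) -> proper_coloring (slot_coloring kap') ->
    (forall i, i \notin U -> kap i = kap' i) ->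
    (forall i j, i \in U :\: V -> j \in U -> kap' j != kap i) ->
    V \subset U ->
  exists m, reach m (slot_coloring kap) (slot_coloring kap') /\ m <= weight U + weight V.
Proof.
move=> + pk'; have [n cUV] := ubnP (#|U| + #|V|).
elim: n U V kap cUV => // n IH U V kap cUV pk eqU evU VU.
have [U0|/set0Pn[i0 i0U]] := eqVneq U set0.
  exists 0; split=> //; suff -> : slot_coloring kap = slot_coloring kap' by exact: reach0.
  by apply/ffunP => x; rewrite !ffunE eqU // U0 inE.
(* Either some slot of [U] has a target held by no other slot of [U] and moves there, or every
   target is held within [U]. *)
have [/existsP[i /andP[iU /forallP ifree]]|stuck] := boolP
    [exists i, (i \in U) && [forall j, (j \in U) && (j != i) ==> (kap j != kap' i)]].
  have freei x y : slot x = i -> sedge x y -> kap (slot y) != kap' i.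
    move=> sx xy; have := ifree (slot y).
    have -> : slot y != i by rewrite eq_sym -sx slot_proper.
    rewrite andbT; case: (boolP (slot y \in U)) => //= yU _.
    rewrite eqU // -sx; have /proper_coloringP/(_ _ _ xy) := pk'.
    by rewrite !ffunE eq_sym => /eqP.
  have r := recolor_slot pk freei; have [_ pk1] := reach_proper r.
  have cV : #|V :\ i| <= #|V| by apply/subset_leq_card/subsetDl.
  have [||||m [r1 le1]] := IH (U :\ i) (V :\ i) _ _ pk1.
  - by move: cUV; rewrite (cardsD1 i U) iU; lia.
  - move=> j; rewrite !inE negb_and negbK; case: eqP => [->//|_ /=]; exact: eqU.
  - move=> j l; rewrite !inE => /andP[+ /andP[ji jU]] /andP[_ lU].
    by rewrite ji (negPf ji) /= => jV; apply: evU => //; rewrite inE jV.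
  - exact: setSD.
  exists (#|slot_class i| + m); split; first exact: reach_trans r1.
  rewrite (weightD1 iU) -addnA leq_add2l; apply: leq_trans le1 _.
  rewrite leq_add2l; apply/subset_leq_card/subsetP => x.
  by rewrite !inE => /andP[].
have stuckP i : i \in U -> exists2 j, j \in U & kap j = kap' i.
  move=> iU; move: stuck; rewrite negb_exists => /forallP/(_ i).
  rewrite iU /= negb_forall => /existsP[j].
  by rewrite negb_imply negbK => /andP[/andP[jU _] /eqP]; exists j.
have [j jU Ej] := stuckP i0 i0U.
(* Slots moved out of the way hold no target colour, so [j] has not been moved yet. *)
have jV : j \in V.
  apply: contraT => jV; have := evU j i0; rewrite inE jV jU Ej eqxx.
  by move=> /(_ isT i0U).
(* For the empty bag the slot colours are [kap] and the constant colouring is a dummy. As all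
   targets are held by slots, [e] is no target. *)
have [e eN] := avoid_slot_colors kap [ffun=> kap j] (@no_ctx G s).
have r := @recolor_slot kap j e pk (fun x y _ _ => eN (slot y)).
have [_ pk1] := reach_proper r.
have [||||m [r1 le1]] := IH U (V :\ j) _ _ pk1.
- by move: cUV; rewrite (cardsD1 j V) jV; lia.
- by move=> i iU; rewrite eqU //; case: eqP => // E; rewrite E jU in iU.
- move=> i l; rewrite !inE negb_and negbK => /andP[ijV iU] lU.
  case: eqP ijV => [_ _|_ /= iV]; last by apply: evU => //; rewrite inE iV.
  have [j' _ <-] := stuckP l lU; exact: eN.
- by apply: subset_trans VU; exact: subsetDl.
exists (#|slot_class j| + m); split; first exact: reach_trans r1.
by rewrite (weightD1 jV) addnCA leq_add2l.
Qed.

End Recoloring.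

(** * Connectedness and diameter of the recolouring graph *)

Lemma mixing_of_reach (G : sgraph) (k N : nat) :
    (exists f : {ffun G -> 'I_k}, proper_coloring f) ->
    (forall f g : {ffun G -> 'I_k}, proper_coloring f -> proper_coloring g ->
       exists m, reach m f g /\ m <= N) ->
  mixing G k /\ recoloring_diameter G k <= N.
Proof.
move=> [f0 pf0] conn.
have walk (f g : recoloring_graph G k) : exists p,
    [/\ path (@sedge (recoloring_graph G k)) f p, last f p = g & size p <= N].
  have [m [r le]] := conn _ _ (valP f) (valP g).
  have [p [fp lp sp]] := reach_walk r.
  by exists p; split=> //; apply: leq_trans le.
have con (f g : recoloring_graph G k) : connect (@sedge (recoloring_graph G k)) f g.
  by have [p [fp lp _]] := walk f g; apply/connectP; exists p.
split.
  by split=> //; apply/card_gt0P; exists (Sub f0 pf0 : coloring G k).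
apply/bigmax_leqP => f _; apply/bigmax_leqP => g _.
have [p [fp lp sp]] := walk f g; apply: leq_trans sp.
have [_] := gdistP (con f g); apply.
by apply/existsP; exists (in_tuple p); rewrite /= fp lp eqxx.
Qed.

(** Two normalisations, the second reversed, cost at most [n ^ 2] each; moving the slots in between
    costs at most [2 * n]. *)
Lemma reach_bound (G H : sgraph) (B : H -> {set G}) (s k : nat)
    (f g : {ffun G -> 'I_k}) :
    tree_decomposition B -> (forall i, #|B i| <= s.+1) -> s.+1 < k ->
    proper_coloring f -> proper_coloring g ->
  exists m, reach m f g /\ m <= 2 * (#|G| ^ 2 + #|G|).
Proof.
move=> td cB ltsk pf pg.
have [slot slot_inj] := slot_exists td cB.
have sp := slot_proper td slot_inj.
have [T [uT allT cT]] := vtree_exists td slot_inj.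
have ok : tree_ok slot T (@no_ctx G s) by split.
have [kf [mf [rf lef]]] := normalize_sqr sp ltsk ok allT pf.
have [kg [mg [rg leg]]] := normalize_sqr sp ltsk ok allT pg.
have [_ pkf] := reach_proper rf; have [_ pkg] := reach_proper rg.
have [|||m [r le]] := @permute_slots G k s slot sp ltsk kf kg setT setT pkf pkg.
- by move=> i; rewrite inE.
- by move=> i j; rewrite !inE.
- exact: subxx.
exists (mf + m + mg); split.
  exact: reach_trans (reach_trans rf r) (reach_sym rg).
have w : weight slot setT <= #|G| by exact: max_card.
by rewrite mulnDr; lia.
Qed.

Theorem theorem2 (G : sgraph) (k : nat)
    (hk : (treewidth G + 2 <= k%:Z)%R) :
  mixing G k /\ recoloring_diameter G k <= 2 * (#|G| ^ 2 + #|G|).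
Proof.
move: hk; rewrite /treewidth.
case: ex_minnP => m /asboolP[H [B [td mB]]] _ hk.
have ltmk : m < k by lia.
have cB i : #|B i| <= m by rewrite -mB; exact: (leq_bigmax i).
(* Here [m] is the treewidth plus one. If [m = 0], all bags are empty and the graph has no
   vertices. *)
apply: mixing_of_reach => [|f g pf pg]; case: m ltmk {mB hk} cB => [|s] ltsk cB.
- have noG (x : G) : False.
    have [i xi] := td_vertex td x; have := cB i.
    by rewrite leqn0 cards_eq0 => /eqP E; rewrite E inE in xi.
  by exists [ffun=> Ordinal ltsk]; apply/proper_coloringP => x; case: (noG x).
- have [slot slot_inj] := slot_exists td cB.
  (* The slots themselves serve as colours. *)
  exists [ffun x => widen_ord (ltnW ltsk) (slot x)].
  apply/proper_coloringP => x y /(slot_proper td slot_inj)/eqP xy.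
  by rewrite !ffunE => /(congr1 val)/= E; apply: xy; apply: val_inj.
- exists 0; split=> //; suff <- : f = g by exact: reach0.
  apply/ffunP => x; have [i xi] := td_vertex td x; have := cB i.
  by rewrite leqn0 cards_eq0 => /eqP E; rewrite E inE in xi.
- exact: reach_bound td cB ltsk pf pg.
Qed.
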